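(* Let $n_0,r_0$ be positive integers, let $(i_0,j_0)$ be a position with $1\le i_0\le n_0$, $1\le j_0\le r_0$, and let $s$ be the biggest positive integer such that $Z_{i_0+s-1,j_0+s-1}\in\mathcal{O}_q(M(n_0,r_0))$. Assume $s\ge2$. Let $M$ be the subalgebra of $\mathcal{O}_q(M(n_0,r_0))$ generated by the $Z_{i_0+a,j_0+b}$ with $0\le a,b\le s-1$ (isomorphic to $\mathcal{O}_q(M(s,s))$), and number its rows and columns $0,1,\dots,s-1$ (row $a$ being row $i_0+a$, column $b$ being column $j_0+b$). In $M$ consider the quantum minors $$X_t=\xi^{\{0,\dots,s-2\}}_{\{0,\dots,s-2\}},\quad X_b=\xi^{\{1,\dots,s-1\}}_{\{1,\dots,s-1\}},\quad X_o=\xi^{\{1,\dots,s-2\}}_{\{1,\dots,s-2\}},$$ $$D=\xi^{\{0,\dots,s-1\}}_{\{0,\dots,s-1\}},\quad Y_r=\xi^{\{0,\dots,s-2\}}_{\{1,\dots,s-1\}},\quad Y_l=\xi^{\{1,\dots,s-1\}}_{\{0,\dots,s-2\}},$$ where $X_o=1$ if $s=2$. Then $$X_tX_b=X_oD+q^2Y_rY_l .$$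
   Context: $K=\mathbb{Q}(q)$. $\mathcal{O}_q(M(m,n))$ is the associative $K$-algebra generated by $Z_{i,j}$ ($1\le i\le m$, $1\le j\le n$) with relations $Z_{ij}Z_{ik}=q^2Z_{ik}Z_{ij}$ if $j<k$; $Z_{ij}Z_{kj}=q^2Z_{kj}Z_{ij}$ if $i<k$; $Z_{ij}Z_{st}=Z_{st}Z_{ij}$ if $i>s,\ j<t$; $Z_{ij}Z_{st}=Z_{st}Z_{ij}+(q^2-q^{-2})Z_{it}Z_{sj}$ if $i<s,\ j<t$. For $I=\{i_1<\dots<i_r\}$ (rows) and $J=\{j_1<\dots<j_r\}$ (columns), the quantum minor is $\xi^I_J=\sum_{\sigma\in S_r}(-q^2)^{\ell(\sigma)}Z_{i_1,j_{\sigma(1)}}Z_{i_2,j_{\sigma(2)}}\cdots Z_{i_r,j_{\sigma(r)}}$, with $\ell$ the number of inversions. *)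

(* Defs.v *)
From HB Require Import structures.
From mathcomp Require Import all_boot all_order all_fingroup all_algebra zify.
From mathcomp Require Import boolp generic_quotient.
From mathcomp Require Import monalg.

Set Implicit Arguments.
Unset Strict Implicit.
Unset Printing Implicit Defensive.

Import GRing.Theory.
Local Open Scope ring_scope.
Local Open Scope quotient_scope.

(** The field Q(q) and its indeterminate.  The constructions below are made
    for an element [q] of an arbitrary field [K]. *)
Definition Qq : fieldType := {fraction {poly rat}}.
Definition q_var : Qq := tofrac ('X : {poly rat}).

Definition inv_count (r : nat) (sigma : 'S_r) : nat :=
  #|[set p : 'I_r * 'I_r | (p.1 < p.2)%N && (sigma p.2 < sigma p.1)%N]|.

(** The free algebra on the letters [(i, j)].  Rows and columns are numbered
    from 0, so the letter [(i, j)] is the generator Z_{i+1,j+1}. *)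
Notation freealg K m n := {malg K[{fmonom ('I_m * 'I_n)%type}]}.

Section QuantumMatrices.
Context {K : fieldType} (q : K) {m n : nat}.
Local Notation F := (freealg K m n).

Definition letter (i : 'I_m) (j : 'I_n) : F :=
  @mkmalgU {fmonom ('I_m * 'I_n)%type} K (fmu (i, j)) 1.
Local Notation z := letter.

(** [Oq_rel f g] : [f = g] is one of the defining relations. *)
Inductive Oq_rel : F -> F -> Prop :=
| Oq_rel_row (i : 'I_m) (j k : 'I_n) : (j < k)%N ->
    Oq_rel (z i j * z i k) (q ^+ 2 *: (z i k * z i j))
| Oq_rel_col (i k : 'I_m) (j : 'I_n) : (i < k)%N ->
    Oq_rel (z i j * z k j) (q ^+ 2 *: (z k j * z i j))
| Oq_rel_anti (i s : 'I_m) (j t : 'I_n) : (s < i)%N -> (j < t)%N ->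
    Oq_rel (z i j * z s t) (z s t * z i j)
| Oq_rel_diag (i s : 'I_m) (j t : 'I_n) : (i < s)%N -> (j < t)%N ->
    Oq_rel (z i j * z s t)
           (z s t * z i j + (q ^+ 2 - q ^- 2) *: (z i t * z s j)).

(** The two-sided ideal generated by the relations; closure under opposites
    and scalars is multiplication by [- 1] and [c%:A]. *)
Inductive Oq_ideal : F -> Prop :=
| Oq_ideal_gen f g : Oq_rel f g -> Oq_ideal (f - g)
| Oq_ideal0 : Oq_ideal 0
| Oq_idealD f g : Oq_ideal f -> Oq_ideal g -> Oq_ideal (f + g)
| Oq_idealMl f g : Oq_ideal g -> Oq_ideal (f * g)
| Oq_idealMr f g : Oq_ideal f -> Oq_ideal (f * g).

Definition Oq_equiv : rel F := fun f g => `[< Oq_ideal (f - g) >].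

Lemma Oq_idealN f : Oq_ideal f -> Oq_ideal (- f).
Proof. by rewrite -mulN1r; apply: Oq_idealMl. Qed.

Lemma Oq_idealZ c f : Oq_ideal f -> Oq_ideal (c *: f).
Proof. by rewrite -[f in c *: f]mul1r scalerAl; apply: Oq_idealMl. Qed.

Lemma Oq_equiv_class : equiv_class_of Oq_equiv.
Proof.
split=> [f|f g|g f h].
- by apply/asboolP; rewrite subrr; exact: Oq_ideal0.
- by apply/asboolP/asboolP => /Oq_idealN; rewrite opprB.
- move=> /asboolP fg /asboolP gh; apply/asboolP.
  by rewrite -[f - h](subrKA g); apply: Oq_idealD.
Qed.

Canonical Oq_equivRel := EquivRelPack Oq_equiv_class.
End QuantumMatrices.

Definition Oq (K : fieldType) (q : K) (m n : nat) :=
  {eq_quot @Oq_equiv K q m n}.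

Section OqAlgebra.
Context {K : fieldType} {q : K} {m n : nat}.
Local Notation F := (freealg K m n).
Local Notation Q := (Oq q m n).
Local Notation Oq_ideal := (@Oq_ideal K q m n).
Implicit Types (f g : F) (x y : Q).

HB.instance Definition _ := Choice.on Q.
HB.instance Definition _ := EqQuotient.on Q.

Let p (f : F) : Q := \pi_Q f.

Lemma Oq_piP f g : p f = p g <-> Oq_ideal (f - g).
Proof.
split=> [/eqP|I].
- by rewrite /p eqmodE => /asboolP.
- by apply/eqP; rewrite /p eqmodE; apply/asboolP.
Qed.

Lemma Oq_reprK x : p (repr x) = x.
Proof. exact: reprK. Qed.

Definition Oq_opp x : Q := p (- repr x).
Definition Oq_add x y : Q := p (repr x + repr y).
Definition Oq_mul x y : Q := p (repr x * repr y).
Definition Oq_scale (c : K) x : Q := p (c *: repr x).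

Lemma Oq_repr_pi f : Oq_ideal (repr (p f) - f).
Proof. by apply/Oq_piP; rewrite Oq_reprK. Qed.

Lemma Oq_pi_opp f : Oq_opp (p f) = p (- f).
Proof. by apply/Oq_piP; rewrite -opprD; apply: Oq_idealN; exact: Oq_repr_pi. Qed.

Lemma Oq_pi_add f g : Oq_add (p f) (p g) = p (f + g).
Proof.
by apply/Oq_piP; rewrite opprD addrACA; apply: Oq_idealD; exact: Oq_repr_pi.
Qed.

Lemma Oq_pi_mul f g : Oq_mul (p f) (p g) = p (f * g).
Proof.
apply/Oq_piP; set f' := repr (p f); set g' := repr (p g).
have -> : f' * g' - f * g = (f' - f) * g' + f * (g' - g).
  by rewrite mulrBl mulrBr subrKA.
by apply: Oq_idealD; [apply: Oq_idealMr|apply: Oq_idealMl]; exact: Oq_repr_pi.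
Qed.

Lemma Oq_pi_scale c f : Oq_scale c (p f) = p (c *: f).
Proof. by apply/Oq_piP; rewrite -scalerBr; apply: Oq_idealZ; exact: Oq_repr_pi. Qed.

Lemma Oq_elim (P : Q -> Prop) : (forall f, P (p f)) -> forall x, P x.
Proof. by move=> H x; rewrite -(Oq_reprK x). Qed.

Lemma Oq_addA : associative Oq_add.
Proof.
by elim/Oq_elim=> f; elim/Oq_elim=> g; elim/Oq_elim=> h; rewrite !Oq_pi_add addrA.
Qed.
Lemma Oq_addC : commutative Oq_add.
Proof. by elim/Oq_elim=> f; elim/Oq_elim=> g; rewrite !Oq_pi_add addrC. Qed.
Lemma Oq_add0 : left_id (p 0) Oq_add.
Proof. by elim/Oq_elim=> f; rewrite !Oq_pi_add add0r. Qed.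
Lemma Oq_addN : left_inverse (p 0) Oq_opp Oq_add.
Proof. by elim/Oq_elim=> f; rewrite Oq_pi_opp Oq_pi_add addNr. Qed.

HB.instance Definition _ :=
  GRing.isZmodule.Build Q Oq_addA Oq_addC Oq_add0 Oq_addN.

Lemma Oq_mulA : associative Oq_mul.
Proof.
by elim/Oq_elim=> f; elim/Oq_elim=> g; elim/Oq_elim=> h; rewrite !Oq_pi_mul mulrA.
Qed.
Lemma Oq_mul1 : left_id (p 1) Oq_mul.
Proof. by elim/Oq_elim=> f; rewrite !Oq_pi_mul mul1r. Qed.
Lemma Oq_mulr1 : right_id (p 1) Oq_mul.
Proof. by elim/Oq_elim=> f; rewrite !Oq_pi_mul mulr1. Qed.
Lemma Oq_mulDl : left_distributive Oq_mul +%R.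
Proof.
elim/Oq_elim=> f; elim/Oq_elim=> g; elim/Oq_elim=> h.
by rewrite /+%R /= !(Oq_pi_add, Oq_pi_mul) mulrDl.
Qed.
Lemma Oq_mulDr : right_distributive Oq_mul +%R.
Proof.
elim/Oq_elim=> f; elim/Oq_elim=> g; elim/Oq_elim=> h.
by rewrite /+%R /= !(Oq_pi_add, Oq_pi_mul) mulrDr.
Qed.

Lemma mcoeff1_letter i j : mcoeff mone (@letter K m n i j) = 0.
Proof.
rewrite /letter mcoeffU; case: eqP => // e.
by have := congr1 (@fdeg _) e; rewrite fdeg1 fdegU.
Qed.

(** The quotient is nonzero: every relation has zero constant term. *)
Lemma Oq_ideal_mcoeff1 f : Oq_ideal f -> mcoeff mone f = 0.
Proof.
have M g h : mcoeff mone (g * h) = mcoeff mone g * mcoeff mone h.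
  exact: (mcoeff1g_is_multiplicative _ _).1.
have zM i j g : mcoeff mone (letter i j * g) = 0.
  by rewrite M mcoeff1_letter mul0r.
elim=> {f} [f g fg | | f g _ ef _ eg | f g _ eg | f g _ ef].
- rewrite mcoeffB; case: fg => [i j k _|i k j _|i j s t _ _|i j s t _ _].
  + by rewrite mcoeffZ [X in X - _]zM [X in _ * X]zM mulr0 subrr.
  + by rewrite mcoeffZ [X in X - _]zM [X in _ * X]zM mulr0 subrr.
  + by rewrite [X in X - _]zM [X in _ - X]zM subrr.
  + rewrite mcoeffD mcoeffZ [X in X - _]zM [X in _ - (X + _)]zM [X in _ * X]zM.
    by rewrite mulr0 addr0 subrr.
- exact: mcoeff0.
- by rewrite mcoeffD ef eg addr0.
- by rewrite M eg mulr0.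
- by rewrite M ef mul0r.
Qed.

Lemma Oq_1neq0 : p 1 != 0 :> Q.
Proof.
apply/eqP => /Oq_piP /Oq_ideal_mcoeff1 /eqP.
by rewrite subr0 rmorph1 oner_eq0.
Qed.

HB.instance Definition _ := GRing.Zmodule_isNzRing.Build Q
  Oq_mulA Oq_mul1 Oq_mulr1 Oq_mulDl Oq_mulDr Oq_1neq0.

Lemma Oq_scaleA a b x : Oq_scale a (Oq_scale b x) = Oq_scale (a * b) x.
Proof. by elim/Oq_elim: x => f; rewrite !Oq_pi_scale scalerA. Qed.
Lemma Oq_scale1 : left_id 1 Oq_scale.
Proof. by elim/Oq_elim=> f; rewrite Oq_pi_scale scale1r. Qed.
Lemma Oq_scaleDr : right_distributive Oq_scale +%R.
Proof.
move=> c; elim/Oq_elim=> f; elim/Oq_elim=> g.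
by rewrite /+%R /= !(Oq_pi_add, Oq_pi_scale) scalerDr.
Qed.
Lemma Oq_scaleDl x : {morph Oq_scale^~ x : a b / a + b}.
Proof.
move=> a b; elim/Oq_elim: x => f.
by rewrite [RHS]/+%R /= !(Oq_pi_add, Oq_pi_scale) scalerDl.
Qed.

HB.instance Definition _ := GRing.Zmodule_isLmodule.Build K Q
  Oq_scaleA Oq_scale1 Oq_scaleDr Oq_scaleDl.

Lemma Oq_scaleAl (c : K) x y : c *: (x * y) = (c *: x) * y.
Proof.
elim/Oq_elim: x => f; elim/Oq_elim: y => g.
by rewrite /*:%R /*%R /= !(Oq_pi_scale, Oq_pi_mul) scalerAl.
Qed.

HB.instance Definition _ := GRing.Lmodule_isLalgebra.Build K Q Oq_scaleAl.

Lemma freealg_scaleAr (c : K) f g : c *: (f * g) = f * (c *: g).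
Proof.
have fC : malgC c * f = f * malgC c.
  rewrite [LHS]fgmulUg [RHS]fgmulgU.
  by apply: eq_bigr => k _; rewrite mulrC mul1m mulm1.
by rewrite -[LHS]mul_malgC mulrA fC -mulrA mul_malgC.
Qed.

Lemma Oq_scaleAr (c : K) x y : c *: (x * y) = x * (c *: y).
Proof.
elim/Oq_elim: x => f; elim/Oq_elim: y => g.
by rewrite /*:%R /*%R /= !(Oq_pi_scale, Oq_pi_mul) freealg_scaleAr.
Qed.

HB.instance Definition _ := GRing.Lalgebra_isAlgebra.Build K Q Oq_scaleAr.

Definition Z (i : 'I_m) (j : 'I_n) : Q := \pi_Q (letter i j).
End OqAlgebra.

Section GeneratedSubalgebra.
Context {K : fieldType} {A : algType K} (S : A -> Prop).

Definition in_gensubalg : {pred A} := fun x =>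
  `[< forall P : {pred A}, subalg_closed P -> (forall y, S y -> y \in P) ->
        x \in P >].

Lemma gensubalg_closed : subalg_closed in_gensubalg.
Proof.
split=> [|c x y /asboolP hx /asboolP hy|x y /asboolP hx /asboolP hy];
  apply/asboolP => P cP SP; have [P1 Plin PM] := cP.
- exact: P1.
- by apply: Plin; [apply: hx|apply: hy].
- by apply: PM; [apply: hx|apply: hy].
Qed.

Lemma gensubalg_gen x : S x -> x \in in_gensubalg.
Proof. by move=> Sx; apply/asboolP => P _; apply. Qed.

Record gensubalg := GenSubalg {
  gensubalg_val :> A;
  gensubalg_valP : gensubalg_val \in in_gensubalg }.

HB.instance Definition _ := [isSub for gensubalg_val].
HB.instance Definition _ := [Choice of gensubalg by <:].
HB.instance Definition _ :=
  GRing.SubChoice_isSubAlgebra.Build K A in_gensubalg gensubalg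
    (GRing.subalg_closed_semi gensubalg_closed).
End GeneratedSubalgebra.

(** The quantum minor xi^I_J of a matrix [z] of elements of an algebra.
    [enum_val] lists a subset of ['I_m] in increasing order, and [\prod] is
    taken in increasing order of the row index.  For [I] and [J] empty the
    minor is [1], see [qminor0]. *)
Definition qminor {K : fieldType} (q : K) {A : algType K} {m n : nat}
    (z : 'I_m -> 'I_n -> A) (I : {set 'I_m}) (J : {set 'I_n}) (IJ : #|I| = #|J|) :
    A :=
  \sum_(sigma : 'S_#|I|) (- q ^+ 2) ^+ inv_count sigma *:
    \prod_(k < #|I|) z (enum_val k) (enum_val (cast_ord IJ (sigma k))).

Lemma qminor0 {K : fieldType} (q : K) {A : algType K} {m n : nat}
    (z : 'I_m -> 'I_n -> A) (I : {set 'I_m}) (J : {set 'I_n}) (IJ : #|I| = #|J|) :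
  I = set0 -> qminor q z IJ = 1.
Proof.
rewrite /qminor; set r := #|I| => I0.
have noI (k : 'I_r) : False.
  by have := ltn_ord k; rewrite /r [in X in (_ < X)%N]I0 cards0.
rewrite (bigD1 1%g) //= [X in _ + X]big1 => [|sigma /negP sigma1]; last first.
  by case: sigma1; apply/eqP/permP => k; case: (noI k).
rewrite big1 => [|k _]; last by case: (noI k).
rewrite /inv_count (_ : [set _ | _] = set0) ?cards0 ?expr0 ?scale1r ?addr0 //.
by apply/setP => -[k l]; case: (noI k).
Qed.

(** The indices [lo, lo + 1, ..., hi - 1]. *)
Definition itv_set (s lo hi : nat) : {set 'I_s} :=
  [set a : 'I_s | (lo <= a < hi)%N].

Lemma card_itv_set s : #|itv_set s 0 (s - 1)| = #|itv_set s 1 s|.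
Proof.
rewrite -(card_imset _ rev_ord_inj); apply: eq_card => a.
rewrite -[a in LHS]rev_ordK mem_imset; last exact: rev_ord_inj.
by rewrite !inE ltn_ord andbT /=; case: a; case: s => // s a /= ?; lia.
Qed.

Section Block.
Context {K : fieldType} (q : K) {n0 r0 s : nat} {i0 : 'I_n0} {j0 : 'I_r0}.

Lemma shift_ord_proof n (i : 'I_n) (h : (i + s - 1 < n)%N) (a : 'I_s) :
  (i + a < n)%N.
Proof.
apply: leq_ltn_trans h; case: a; case: s => // t a at_.
by rewrite addnS subn1 leq_add2l.
Qed.

Definition shift_ord n (i : 'I_n) (h : (i + s - 1 < n)%N) (a : 'I_s) : 'I_n :=
  Ordinal (shift_ord_proof h a).

Context (hi : (i0 + s - 1 < n0)%N) (hj : (j0 + s - 1 < r0)%N).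

Definition block_gen (x : Oq q n0 r0) : Prop :=
  exists a b : 'I_s, x = Z (shift_ord hi a) (shift_ord hj b).

Definition block_subalg : algType K := gensubalg block_gen.

Definition block_Z (a b : 'I_s) : block_subalg :=
  GenSubalg (gensubalg_gen
    (ex_intro _ a (ex_intro _ b erefl) : block_gen (Z _ _))).
End Block.

(* Main.v *)
From mathcomp Require Import generic_quotient monalg.
Require Import Defs.
From mathcomp Require Import all_boot all_order all_fingroup all_algebra.
From mathcomp Require Import zify.

(** The identity is the quantum analogue of the Desnanot-Jacobi (Dodgson)
    identity, and it holds for every square matrix [z] of elements of an algebra
    whose entries satisfy the relations of quantum matrices.  Write
    [e = - q ^+ 2].

    Let x_0, ..., x_(n-1) be the generators of the quantum exterior algebra:
    x_j x_j = 0 and x_k x_j = e x_j x_k for j < k.  Put w_i = sum_j z_ij x_j for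
    the i-th row of [z].  The defining relations of quantum matrices give
    w_i w_i = 0 and w_k w_i = e w_i w_k for i < k ([wedge_row_sqr],
    [wedge_row_swap]), and the coefficient at x_J of the product of the w_i, i in
    I, is the minor on the rows I and the columns J ([qminor_rows]).  The
    relations are invariant under transposition, and a minor is equal to the
    minor of the transposed matrix ([qminor_cols]), since two entries that are
    in the order of the rows but not in that of the columns commute.  So the same
    calculus applies to the columns.

    With rows and columns numbered 0, ..., r+1, let M_i be the minor on the rows
    top - i and the columns 1, ..., r, and let N_j be the minor on the rows
    1, ..., r+1 and all the columns but j.  Expanding the product w_i w_1 ... w_(r+1) gives
    [row_expansion]: the sum over j of e^j z_ij N_j is D for i = 0 and 0 for i > 0,
    because w_i is then repeated.  Multiplying the product of the columns 1, ..., r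
    by the column j gives [col_expansion]: the sum over i in top of e^(r-i) M_i z_ij
    is e^r X_t for j = 0, is 0 for 0 < j <= r, and is Y_r for j = r+1.  Now sum
    e^(r-i) e^j M_i z_ij N_j over i in top and over j.  Summing over j first gives
    e^r X_o D, and summing over i first gives
    e^r X_t X_b + e^(r+1) Y_r Y_l.  Since e is invertible, X_o D = X_t X_b + e Y_r Y_l. *)

Set Implicit Arguments.
Unset Strict Implicit.
Unset Printing Implicit Defensive.

Import Order.TTheory GRing.Theory.
Local Open Scope ring_scope.

(** * Multiplication by a vector in a quantum exterior algebra *)

Section Wedge.
Context {K : fieldType} (e : K) {A : algType K} {n : nat}.
Local Notation vec := {ffun {set 'I_n} -> A}.
Implicit Types (S : {set 'I_n}) (u v : 'I_n -> A) (f g : vec).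

Definition below S (j : 'I_n) := #|[set k in S | (k < j)%N]|.
Definition above S (j : 'I_n) := #|[set k in S | (j < k)%N]|.

(** An element of A (x) Lambda, with Lambda the quantum exterior algebra, is
    encoded by the function that sends [S] to its coefficient at the increasing
    monomial x_S.  [wedgel u] is the left multiplication by sum_j u_j x_j: moving
    x_j to its place in x_S passes the [below S j] smaller generators.  For
    [wedger u], the multiplication on the right, the larger ones are passed.  The
    unit of A (x) Lambda is [vac]. *)
Definition wedgel u f : vec :=
  [ffun S : {set 'I_n} => \sum_(j in S) e ^+ below S j *: (u j * f (S :\ j))].
Definition wedger u f : vec :=
  [ffun S : {set 'I_n} => \sum_(j in S) e ^+ above S j *: (f (S :\ j) * u j)].
Definition vac : vec := [ffun S : {set 'I_n} => (S == set0)%:R].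

Lemma belowD1 S a b : a \in S ->
  below S b = ((a < b) + below (S :\ a) b)%N.
Proof.
move=> aS; rewrite /below (cardsD1 a) !inE aS /=; congr (_ + _)%N.
by apply: eq_card => k; rewrite !inE; case: (k == a).
Qed.

Lemma aboveD1 S a b : a \in S ->
  above S b = ((b < a) + above (S :\ a) b)%N.
Proof.
move=> aS; rewrite /above (cardsD1 a) !inE aS /=; congr (_ + _)%N.
by apply: eq_card => k; rewrite !inE; case: (k == a).
Qed.

Lemma setD1C S a b : S :\ a :\ b = S :\ b :\ a.
Proof. by rewrite !setDDl setUC. Qed.

Lemma wedgelZ u c f : wedgel u (c *: f) = c *: wedgel u f.
Proof.
apply/ffunP => S; rewrite !ffunE scaler_sumr; apply: eq_bigr => j _.
by rewrite ffunE -scalerAr !scalerA mulrC.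
Qed.

Lemma wedgel0 u : wedgel u 0 = 0.
Proof. by rewrite -(scale0r 0) wedgelZ !scale0r. Qed.

Lemma sum_setD1_lt S a (F : 'I_n -> A) :
  \sum_(b in S :\ a) F b =
  \sum_(b in S | (a < b)%N) F b + \sum_(b in S | (b < a)%N) F b.
Proof.
rewrite (bigID (fun b : 'I_n => (a < b)%N)) /=; congr (_ + _); apply: eq_bigl => b;
  rewrite !inE -(inj_eq val_inj) /=; case: (b \in S); rewrite ?andbF ?andbT //=; lia.
Qed.

(** Each pair of columns a < b occurs twice, according to which of the two is
    removed first, and the second occurrence has one more factor [e].  The
    relations between two vectors are thus read off the 2x2 expressions
    u_a v_b + e u_b v_a. *)
Lemma wedgel2 u v f S :
  wedgel u (wedgel v f) S = \sum_(a in S) \sum_(b in S | (a < b)%N)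
    e ^+ (below S a + below (S :\ a) b) *:
      ((u a * v b + e *: (u b * v a)) * f (S :\ a :\ b)).
Proof.
rewrite !ffunE.
under eq_bigr => a _ do rewrite ffunE mulr_sumr scaler_sumr sum_setD1_lt.
rewrite big_split /= [X in _ + X](exchange_big_dep (mem S)) /=; last first.
  by move=> a b _ /andP[].
rewrite -big_split /=; apply: eq_bigr => a aS.
under [X in _ + X]eq_bigl => b do rewrite aS.
rewrite -big_split /=; apply: eq_bigr => b /andP[bS ab].
rewrite -!scalerAr !scalerA !mulrA -!exprD setD1C mulrDl scalerDr; congr (_ + _).
rewrite -scalerAl scalerA -exprSr; congr (e ^+ _ *: _).
by rewrite (belowD1 a bS) (belowD1 b aS); lia.
Qed.

(** This is associativity in A (x) Lambda.  The powers of [e] agree because, when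
    b < a, moving x_a to the front and x_b to the back are each shortened by one
    step if the other generator has already been removed. *)
Lemma wedgelr u v f : wedgel u (wedger v f) = wedger v (wedgel u f).
Proof.
apply/ffunP => S; rewrite !ffunE.
under eq_bigr => a _ do rewrite ffunE mulr_sumr scaler_sumr.
under [RHS]eq_bigr => a _ do rewrite ffunE mulr_suml scaler_sumr.
rewrite (exchange_big_dep (mem S)) /= => [|a b _]; last by rewrite inE => /andP[].
apply: eq_bigr => b bS; apply: eq_big => [a|a /andP[aS]].
  by rewrite !inE bS andbT eq_sym andbC.
rewrite !inE => /andP[ba _].
rewrite -!scalerAr -!scalerAl !scalerA -!exprD setD1C mulrA; congr (e ^+ _ *: _).
rewrite (belowD1 a bS) (aboveD1 b aS); lia.
Qed.

Lemma wedgel_vac u : wedgel u vac = wedger u vac.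
Proof.
apply/ffunP => S; rewrite !ffunE; apply: eq_bigr => j jS; rewrite !ffunE.
case: eqP => [Sj|_]; last by rewrite mulr0 mul0r !scaler0.
have notS k : k \in S -> k = j.
  move=> kS; have := in_set0 k; rewrite -Sj !inE kS andbT.
  by move/negbFE/eqP.
rewrite mulr1 mul1r /below /above !(@eq_card0 _ (mem [set _ in _ | _])) //= => k;
  by rewrite !inE; apply/negP => /andP[/notS->]; rewrite ltnn.
Qed.
End Wedge.
Arguments vac {K A n}.

(** * The rows of a quantum matrix *)

Section Words.
Context {K : fieldType} {q : K} (q0 : q != 0) {A : algType K} {m n : nat}.

Definition quantum_matrix (z : 'I_m -> 'I_n -> A) : Prop :=
  [/\ forall (i : 'I_m) (j k : 'I_n), (j < k)%N -> z i j * z i k = q ^+ 2 *: (z i k * z i j),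
      forall (i k : 'I_m) (j : 'I_n), (i < k)%N -> z i j * z k j = q ^+ 2 *: (z k j * z i j),
      forall (i s : 'I_m) (j t : 'I_n), (s < i)%N -> (j < t)%N -> z i j * z s t = z s t * z i j &
      forall (i s : 'I_m) (j t : 'I_n), (i < s)%N -> (j < t)%N ->
        z i j * z s t = z s t * z i j + (q ^+ 2 - q ^- 2) *: (z i t * z s j)].

Context {z : 'I_m -> 'I_n -> A} (qz : quantum_matrix z).
Local Notation e := (- q ^+ 2).
Local Notation vec := {ffun {set 'I_n} -> A}.
Implicit Types (f : vec) (w : seq 'I_m).

(** The left multiplication by the rows w_i of [z], for i along the word [w]. *)
Definition wedge_word (z : 'I_m -> 'I_n -> A) w f : vec :=
  foldr (fun i => wedgel e (z i)) f w.

Lemma wedge_row_sqr i f : wedgel e (z i) (wedgel e (z i) f) = 0.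
Proof.
have [row _ _ _] := qz.
apply/ffunP => S; rewrite wedgel2 ffunE big1 // => a _; rewrite big1 // => b /andP[_ ab].
by rewrite row // scaleNr subrr mul0r scaler0.
Qed.

(** The rows satisfy the same q-commutation as the generators x_j: on the columns
    a < b, this is the combination of the relations for the diagonal and the
    antidiagonal of the 2x2 submatrix. *)
Lemma wedge_row_swap (i k : 'I_m) f : (i < k)%N ->
  wedgel e (z k) (wedgel e (z i) f) = e *: wedgel e (z i) (wedgel e (z k) f).
Proof.
move=> ik; have [_ _ anti diag] := qz.
apply/ffunP => S; rewrite wedgel2 [RHS]ffunE wedgel2.
rewrite scaler_sumr; apply: eq_bigr => a _.
rewrite scaler_sumr; apply: eq_bigr => b /andP[_ ab].
rewrite [RHS]scalerA (mulrC e) -scalerA; congr (_ *: _); rewrite [RHS]scalerAl; congr (_ * _).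
rewrite (anti _ _ _ _ ik ab) (diag _ _ _ _ ik ab).
rewrite -addrA -scalerDl [q ^+ 2 - _ + _]addrAC subrr add0r scalerDr scalerA.
by rewrite mulrNN divff ?expf_neq0 // scale1r addrC.
Qed.

(** The row i can be brought next to its other occurrence, up to an invertible
    scalar, and there its square is zero. *)
Lemma wedge_word_mem i w f : i \in w -> wedgel e (z i) (wedge_word z w f) = 0.
Proof.
elim: w => //= k w IH; rewrite inE => /orP[/eqP->|/IH{}IH]; first exact: wedge_row_sqr.
have [ik|ki|/val_inj->] := ltngtP i k; last exact: wedge_row_sqr.
  apply: (scalerI (_ : e != 0)); first by rewrite oppr_eq0 expf_neq0.
  by rewrite -wedge_row_swap // IH wedgel0 scaler0.
by rewrite wedge_row_swap // IH wedgel0 scaler0.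
Qed.

Lemma wedge_word_nuniq w f : ~~ uniq w -> wedge_word z w f = 0.
Proof.
elim: w => //= k w IH; rewrite negb_and negbK => /orP[/wedge_word_mem|/IH->] //.
exact: wedgel0.
Qed.

Lemma wedge_word_swap (j : 'I_m) w f : all (fun k : 'I_m => (j < k)%N) w ->
  wedge_word z w (wedgel e (z j) f) = e ^+ size w *: wedgel e (z j) (wedge_word z w f).
Proof.
elim: w => [|k w IH] /=; first by rewrite scale1r.
by move=> /andP[jk /IH->]; rewrite wedgelZ wedge_row_swap // scalerA -exprSr.
Qed.

(** Turns a factor applied first, hence rightmost in the product, into a right
    multiplication, so that the entries of [v] end up on the right of the
    coefficients. *)
Lemma wedge_word_wedger v w f :
  wedge_word z w (wedger e v f) = wedger e v (wedge_word z w f).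
Proof. by elim: w => //= k w ->; rewrite wedgelr. Qed.

End Words.
Arguments quantum_matrix {K} q {A m n} z.
Arguments wedge_word {K} q {A m n} z w f.

Lemma quantum_matrix_tr (K : fieldType) (q : K) (A : algType K) m n
    (z : 'I_m -> 'I_n -> A) :
  quantum_matrix q z -> quantum_matrix q (fun j i => z i j).
Proof.
move=> [row col anti diag]; split=> [i j k|i k j|i s j t si jt|i s j t is_ jt].
- exact: col.
- exact: row.
- by rewrite (anti _ _ _ _ jt si).
- by rewrite (diag _ _ _ _ jt is_) (anti _ _ _ _ jt is_).
Qed.

(** * The quantum determinant as a sum over permutations *)

Lemma inv_count_sum r (s : 'S_r) :
  inv_count s = (\sum_(a < r) \sum_(b < r) ((a < b) && (s b < s a)))%N.
Proof.
rewrite /inv_count -sum1_card pair_big /= big_mkcond /=.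
by apply: eq_bigr => -[a b] _; rewrite inE /=; case: ifP.
Qed.

Lemma inv_countV r (s : 'S_r) : inv_count s^-1%g = inv_count s.
Proof.
rewrite !inv_count_sum (reindex_inj (@perm_inj _ s)) exchange_big /=.
rewrite (reindex_inj (@perm_inj _ s)) /=.
apply: eq_bigr => a _; apply: eq_bigr => b _.
by rewrite !permK andbC.
Qed.

Lemma sum_bump_lt r (l : nat) : (l <= r)%N -> (\sum_(c < r) (bump l c < l) = l)%N.
Proof.
move=> lr; rewrite -[RHS]subn0 -[RHS]muln1 -sum_nat_const_nat.
rewrite (big_nat_widen _ _ r) // big_mkord [RHS]big_mkcond /=; apply: eq_bigr => c _.
rewrite /bump; case: (leqP l c) => lc; rewrite ?add0n ?add1n; lia.
Qed.

(** The value [l] at [ord0] is inverted with the [l] smaller values, and [lift]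
    keeps the order of the others. *)
Lemma inv_count_lift r (l : 'I_r.+1) (s : 'S_r) :
  inv_count (lift_perm ord0 l s) = (l + inv_count s)%N.
Proof.
rewrite !inv_count_sum big_ord_recl; congr (_ + _)%N.
  rewrite big_ord_recl ltnn add0n -[RHS](@sum_bump_lt r) -1?ltnS // [RHS](reindex_perm s).
  by apply: eq_bigr => b _; rewrite lift_perm_lift lift_perm_id.
apply: eq_bigr => a _; rewrite big_ord_recl ltn0 add0n.
apply: eq_bigr => b _; rewrite !lift_perm_lift.
congr (nat_of_bool (_ && _)); rewrite /= /bump; lia.
Qed.

Section Qdet.
Context {K : fieldType} (e : K) {A : algType K}.

(** The indices are natural numbers, so that passing to a submatrix needs no
    casts between ordinal types. *)
Definition qdet r (w : nat -> nat -> A) : A :=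
  \sum_(s : 'S_r) e ^+ inv_count s *: \prod_(k < r) w k (s k).

(** The Laplace expansion along the first row; [bump l] skips the column [l]. *)
Lemma qdet_expand r w :
  qdet r.+1 w =
  \sum_(l < r.+1) e ^+ l *: (w 0%N l * qdet r (fun k c => w k.+1 (bump l c))).
Proof.
rewrite /qdet; under [RHS]eq_bigr => l _ do rewrite mulr_sumr scaler_sumr.
rewrite pair_big /= (reindex (fun ls : 'I_r.+1 * 'S_r => lift_perm ord0 ls.1 ls.2)) /=.
  apply: eq_bigr => -[l s] _ /=; rewrite inv_count_lift exprD -scalerA -scalerAr.
  congr (_ *: (_ *: _)); rewrite big_ord_recl lift_perm_id; congr (_ * _).
  by apply: eq_bigr => k _; rewrite lift_perm_lift.
apply: onW_bij; apply: inj_card_bij.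
  move=> [l s] [l' s'] /= E.
  have ll' : l = l' by have := congr1 (fun p : 'S__ => p ord0) E; rewrite !lift_perm_id.
  rewrite ll' in E *; congr (_, _); apply/permP => k.
  have := congr1 (fun p : 'S__ => p (lift ord0 k)) E; rewrite /= !lift_perm_lift.
  exact: lift_inj.
by rewrite card_prod !card_Sn card_ord factS.
Qed.

(** A product whose factors commute whenever they are out of order does not
    change when its factors are sorted. *)
Lemma prod_sorted_commute (T : eqType) (lt : rel T) (G : T -> A) (s t : seq T) :
  transitive lt ->
  pairwise (fun x y => lt y x ==> (G x * G y == G y * G x)) s ->
  sorted lt t -> perm_eq s t ->
  \prod_(x <- s) G x = \prod_(x <- t) G x.
Proof.
move=> lt_tr; elim: t s => [|x t IH] s Hs st st_perm.
  by rewrite (perm_nilP st_perm).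
have xs : x \in s by rewrite (perm_mem st_perm) mem_head.
case/splitPr: s / xs Hs st_perm => s1 s2 Hs st_perm.
have st12 : perm_eq (s1 ++ s2) t.
  by rewrite -(perm_cons x) -(permPr st_perm) -cat1s perm_catCA.
rewrite big_cat !big_cons /= -(IH (s1 ++ s2)) ?(path_sorted st) //; last first.
  move: Hs; rewrite !pairwise_cat /= allrel_consr.
  by case/and3P => [/andP[_ ->] -> /andP[_ ->]].
rewrite big_cat /= !mulrA; congr (_ * _).
have : all (fun y => G y * G x == G x * G y) s1.
  apply/allP => y ys1; move: Hs; rewrite pairwise_cat allrel_consr.
  case/andP => [/andP[/allP/(_ y ys1) Hy _] _].
  apply: (implyP Hy); apply: (allP (order_path_min lt_tr st)).
  by rewrite -(perm_mem st12) mem_cat ys1.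
elim: s1 {Hs st_perm st12} => [|y s1 IH1] /=; first by rewrite !big_nil mul1r mulr1.
by case/andP => /eqP yx /IH1 Hx; rewrite big_cons -mulrA Hx !mulrA yx.
Qed.

Lemma ord_enum_ltn_pairwise r : pairwise (fun a b : 'I_r => a < b)%N (enum 'I_r).
Proof.
rewrite -(@pairwise_map _ _ val (fun a b => a < b)%N) val_enum_ord.
by rewrite -sorted_pairwise ?iota_ltn_sorted //; exact: ltn_trans.
Qed.

(** The two sums agree term by term: the product of the entries (k, s k), taken
    by increasing row, is sorted by increasing column.  Two entries out of order
    for this are in antidiagonal position, and so commute. *)
Lemma qdet_tr r w :
  (forall i s j t : nat, (s < i < r)%N -> (j < t < r)%N -> w i j * w s t = w s t * w i j) ->
  qdet r w = qdet r (fun i j => w j i).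
Proof.
move=> anti; rewrite [RHS](reindex_inj invg_inj) /=; apply: eq_bigr => s _.
rewrite inv_countV; congr (_ *: _).
(* [G c] is the entry in column [c]. *)
pose G (c : 'I_r) := w (s^-1 c)%g c.
rewrite (eq_bigr (fun k => G (s k))) => [|k _]; last by rewrite /G permK.
have prodE (F : 'I_r -> A) : \prod_(k < r) F k = \prod_(k <- enum 'I_r) F k.
  by rewrite enumT [index_enum _]unlock.
rewrite !prodE -(big_map s predT).
apply: (@prod_sorted_commute _ (fun a b : 'I_r => a < b)%N) => //.
- by move=> ? ? ?; exact: ltn_trans.
- rewrite pairwise_map; apply: sub_pairwise (ord_enum_ltn_pairwise r) => a b ab /=.
  by apply/implyP => ba; apply/eqP; rewrite /G !permK -anti // ?ab ?ba ltn_ord.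
- by apply: pairwise_sorted; exact: ord_enum_ltn_pairwise.
apply: uniq_perm; rewrite ?(map_inj_uniq (@perm_inj _ s)) ?enum_uniq //.
by move=> a; rewrite mem_enum; apply/mapP; exists (s^-1 a)%g; rewrite ?mem_enum ?permKV.
Qed.

End Qdet.

(** * Minors as coefficients of products of rows or columns *)

Section EnumSet.
Context {n : nat}.
Implicit Types (S : {set 'I_n}).

Lemma sorted_enum_set S : sorted <%O (enum S).
Proof.
rewrite /enum_mem -enumT; apply: sorted_filter; first exact: lt_trans.
have := iota_ltn_sorted 0 n; rewrite -val_enum_ord sorted_map.
by apply: sub_sorted => a b.
Qed.

Lemma enum_set_eq S w : sorted <%O w -> w =i S -> enum S = w.
Proof.
move=> sw wS; apply: irr_sorted_eq (sorted_enum_set S) sw _.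
- exact: lt_trans.
- exact: ltxx.
by move=> a; rewrite mem_enum wS.
Qed.

Lemma below_nth a0 S l : (l < #|S|)%N -> below S (nth a0 (enum S) l) = l.
Proof.
move=> lS; rewrite -[RHS](@count_lt_nth _ _ a0 (enum S) l) ?sorted_enum_set -?cardE //.
rewrite /below -size_filter cardE; congr size; apply: enum_set_eq.
  by apply: sorted_filter (sorted_enum_set S); exact: lt_trans.
by move=> k; rewrite mem_filter mem_enum !inE andbC.
Qed.

Lemma nth_enum_setD1 a0 S l c : (l < #|S|)%N ->
  nth a0 (enum (S :\ nth a0 (enum S) l)) c = nth a0 (enum S) (bump l c).
Proof.
move=> lS; set x := nth a0 _ l.
have -> : enum (S :\ x) = rem x (enum S).
  rewrite rem_filter ?enum_uniq //; apply: enum_set_eq.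
    by apply: sorted_filter (sorted_enum_set S); exact: lt_trans.
  by move=> k; rewrite mem_filter mem_enum !inE.
rewrite remE index_uniq ?enum_uniq -?cardE // nth_cat size_takel; last by rewrite -cardE ltnW.
rewrite /bump; case: ltnP => lc; first by rewrite nth_take // leqNgt lc.
by rewrite nth_drop add1n addSn subnKC.
Qed.

End EnumSet.

Lemma card_itv n lo hi : (hi <= n)%N -> #|itv_set n lo hi| = (hi - lo)%N.
Proof.
move=> hn; rewrite -sum1_card -[RHS]muln1 -sum_nat_const_nat.
rewrite (big_nat_widen _ _ n) // big_geq_mkord.
by apply: eq_bigl => k; rewrite inE andbC.
Qed.

Section Minors.
Context {K : fieldType} {q : K} {A : algType K}.
Local Notation e := (- q ^+ 2).

(** Both sides have the same Laplace expansion along the first row. *)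
Lemma wedge_qdet m n (z : 'I_m -> 'I_n -> A) i0 j0 w (S : {set 'I_n}) :
  size w = #|S| ->
  wedge_word q z w vac S =
  qdet e (size w) (fun k c => z (nth i0 w k) (nth j0 (enum S) c)).
Proof.
elim: w S => [|i w IH] S /= wS.
  have/esym/eqP := wS; rewrite cards_eq0 => /eqP->; rewrite ffunE eqxx /qdet.
  rewrite (bigD1 1%g) //= [X in _ + X]big1 => [|s /negP[]]; last first.
    by apply/eqP; apply/permP => -[].
  by rewrite big_ord0 addr0 inv_count_sum big_ord0 scale1r.
rewrite qdet_expand ffunE -big_enum (big_nth j0) big_mkord -cardE -wS.
apply: eq_bigr => l _; have lS : (l < #|S|)%N by rewrite -wS.
rewrite below_nth // IH; last first.
  have := cardsD1 (nth j0 (enum S) l) S.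
  by rewrite -mem_enum mem_nth -?cardE // -wS => -[].
congr (_ *: (_ * _)); apply: eq_bigr => s _; congr (_ *: _); apply: eq_bigr => k _.
by rewrite nth_enum_setD1.
Qed.

Lemma qminor_qdet m n (z : 'I_m -> 'I_n -> A) i0 j0
    (I : {set 'I_m}) (J : {set 'I_n}) (IJ : #|I| = #|J|) :
  qminor q z IJ = qdet e #|I| (fun k c => z (nth i0 (enum I) k) (nth j0 (enum J) c)).
Proof.
apply: eq_bigr => s _; congr (_ *: _); apply: eq_bigr => k _.
by rewrite (enum_val_nth i0) (enum_val_nth j0).
Qed.

Lemma qminor_rows m n (z : 'I_m.+1 -> 'I_n.+1 -> A)
    (I : {set 'I_m.+1}) (J : {set 'I_n.+1}) (IJ : #|I| = #|J|) :
  qminor q z IJ = wedge_word q z (enum I) vac J.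
Proof. by rewrite (qminor_qdet _ ord0 ord0) (wedge_qdet _ ord0 ord0) -cardE. Qed.

(** The coefficient at the rows [I] of the product of the columns in [J]; this is
    [qminor_rows] for the transposed matrix. *)
Lemma qminor_cols m n (z : 'I_m.+1 -> 'I_n.+1 -> A)
    (I : {set 'I_m.+1}) (J : {set 'I_n.+1}) (IJ : #|I| = #|J|) :
  quantum_matrix q z ->
  qminor q z IJ = wedge_word q (fun j i => z i j) (enum J) vac I.
Proof.
move=> [_ _ anti _].
rewrite (qminor_qdet _ ord0 ord0) (wedge_qdet _ ord0 ord0) -cardE // -IJ.
apply: qdet_tr => i s j t /andP[si ir] /andP[jt tr].
have sr := ltn_trans si ir; have jr := ltn_trans jt tr.
by apply: anti; apply: (sorted_ltn_nth lt_trans _ (sorted_enum_set _));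
   rewrite // inE -cardE -?IJ.
Qed.

End Minors.

(** * The quantum Desnanot-Jacobi identity *)

Lemma enum_itv_cons s lo hi (i : 'I_s) : i = lo :> nat -> (lo < hi)%N ->
  enum (itv_set s lo hi) = i :: enum (itv_set s lo.+1 hi).
Proof.
move=> ilo lohi; apply: enum_set_eq => [|k].
  rewrite sorted_pairwise; last exact: lt_trans.
  rewrite pairwise_cons -sorted_pairwise ?sorted_enum_set ?andbT; last exact: lt_trans.
  by apply/allP => k; rewrite mem_enum inE => /andP[+ _]; rewrite -ilo.
by rewrite inE mem_enum !inE -(inj_eq val_inj) /= ilo; lia.
Qed.

Lemma enum_itv_rcons s lo hi (i : 'I_s) : i = hi :> nat -> (lo <= hi)%N ->
  enum (itv_set s lo hi.+1) = rcons (enum (itv_set s lo hi)) i.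
Proof.
move=> ihi lohi; apply: enum_set_eq => [|k].
  rewrite sorted_pairwise; last exact: lt_trans.
  rewrite pairwise_rcons -sorted_pairwise ?sorted_enum_set ?andbT; last exact: lt_trans.
  by apply/allP => k; rewrite mem_enum inE => /andP[_ +]; rewrite -ihi.
by rewrite mem_rcons inE mem_enum !inE -(inj_eq val_inj) /= ihi; lia.
Qed.

Section Jacobi.
Context {K : fieldType} {q : K} (q0 : q != 0) {A : algType K} {r : nat}.
Local Notation e := (- q ^+ 2).
Local Notation s := r.+2.
Context {z : 'I_s -> 'I_s -> A} (qz : quantum_matrix q z).
Local Notation zT := (fun j i => z i j).
Local Notation top := (itv_set s 0 (s - 1)).
Local Notation bottom := (itv_set s 1 s).
Local Notation middle := (itv_set s 1 (s - 1)).
Local Notation full := (itv_set s 0 s).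

(** The coefficient at [full] of w_i (w_1 ... w_(r+1)). *)
Lemma row_expansion (i : 'I_s) :
  \sum_(j in full) e ^+ below full j *:
      (z i j * wedge_word q z (enum bottom) vac (full :\ j)) =
  if i == ord0 then wedge_word q z (enum full) vac full else 0.
Proof.
transitivity (wedgel e (z i) (wedge_word q z (enum bottom) vac) full).
  by rewrite ffunE.
case: eqP => [->|/eqP i0].
  by rewrite (@enum_itv_cons _ 0 s ord0).
rewrite wedge_word_mem ?ffunE // mem_enum inE ltn_ord andbT lt0n.
by apply: contra_neq i0 => i0; apply: val_inj.
Qed.

(** The coefficient at [top] of the product of the columns 1, ..., r, j.  For
    j = 0, bringing the last column to the front costs one factor [e] for each of
    the r others. *)
Lemma col_expansion (j : 'I_s) :
  \sum_(i in top) e ^+ above top i *: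
      (wedge_word q zT (enum middle) vac (top :\ i) * z i j) =
  if j == ord0 then e ^+ r *: wedge_word q zT (enum top) vac top
  else if j == ord_max then wedge_word q zT (enum bottom) vac top else 0.
Proof.
have qzT := quantum_matrix_tr qz.
transitivity (wedge_word q zT (enum middle) (wedgel e (zT j) vac) top).
  by rewrite wedgel_vac wedge_word_wedger ffunE.
case: eqP => [->|/eqP j0].
  rewrite (wedge_word_swap q0 qzT) ?ffunE; last first.
    by apply/allP => k; rewrite mem_enum inE => /andP[].
  by rewrite -cardE card_itv ?subn1 // (@enum_itv_cons _ 0 _ ord0) // ?ffunE.
have -> w : wedge_word q zT w (wedgel e (zT j) vac) = wedge_word q zT (rcons w j) vac.
  by rewrite /wedge_word foldr_rcons.
case: eqP => [->|/eqP jmax]; first by rewrite subn1 /= -(@enum_itv_rcons _ _ r.+1).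
rewrite (wedge_word_nuniq q0 qzT) ?ffunE // rcons_uniq mem_enum inE.
suff -> : (1 <= j < s - 1)%N by [].
by move: j0 jmax (ltn_ord j); rewrite -!(inj_eq val_inj) /=; lia.
Qed.

(** Both orders of summation in the double sum of e^(r-i) e^j M_i z_ij N_j; the
    common factor e^r then cancels. *)
Lemma quantum_jacobi (tt : #|top| = #|top|) (bb : #|bottom| = #|bottom|)
    (mm : #|middle| = #|middle|) (ff : #|full| = #|full|)
    (tb : #|top| = #|bottom|) (bt : #|bottom| = #|top|) :
  qminor q z tt * qminor q z bb =
  qminor q z mm * qminor q z ff + q ^+ 2 *: (qminor q z tb * qminor q z bt).
Proof.
have e0 : e != 0 by rewrite oppr_eq0 expf_neq0.
pose M i := wedge_word q zT (enum middle) vac (top :\ i).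
pose N j := wedge_word q z (enum bottom) vac (full :\ j).
have ord0_full : ord0 \in full by rewrite inE.
have max_full : ord_max \in full by rewrite inE /=.
have ord0_top : ord0 \in top by rewrite inE.
have full0 : full :\ ord0 = bottom.
  by apply/setP => k; rewrite !inE -(inj_eq val_inj) /=; lia.
have fullmax : full :\ ord_max = top.
  by apply/setP => k; rewrite !inE -(inj_eq val_inj) /=; have := ltn_ord k; lia.
have top0 : top :\ ord0 = middle.
  by apply/setP => k; rewrite !inE -(inj_eq val_inj) /=; lia.
have above0 : above top ord0 = r.
  rewrite /above (_ : [set _ in _ | _] = middle) ?card_itv ?subn1 //.
  by apply/setP => k; rewrite !inE /=; lia.
have below0 : below full ord0 = 0%N.
  by apply: eq_card0 => k; rewrite !inE ltn0 andbF.
have belowmax : below full ord_max = r.+1.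
  rewrite /below (_ : [set _ in _ | _] = top) ?card_itv ?subn1 //.
  by apply/setP => k; rewrite !inE /=; lia.
have rows : \sum_(i in top) \sum_(j in full)
    (e ^+ above top i * e ^+ below full j) *: (M i * z i j * N j) =
    e ^+ r *: (qminor q z mm * qminor q z ff).
  have rowE i : \sum_(j in full)
      (e ^+ above top i * e ^+ below full j) *: (M i * z i j * N j) =
      e ^+ above top i *: (M i *
        if i == ord0 then wedge_word q z (enum full) vac full else 0).
    rewrite -row_expansion mulr_sumr scaler_sumr; apply: eq_bigr => j _.
    by rewrite -scalerAr scalerA mulrA.
  under eq_bigr => i _ do rewrite rowE.
  rewrite (bigD1 ord0) //= big1 => [|i /andP[_ /negPf->]]; last first.
    by rewrite mulr0 scaler0.
  by rewrite addr0 above0 /M top0 (qminor_cols mm qz) (qminor_rows _ ff).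
have cols : \sum_(i in top) \sum_(j in full)
    (e ^+ above top i * e ^+ below full j) *: (M i * z i j * N j) =
    e ^+ r *: (qminor q z tt * qminor q z bb - q ^+ 2 *: (qminor q z tb * qminor q z bt)).
  rewrite exchange_big /=.
  have colE j : \sum_(i in top)
      (e ^+ above top i * e ^+ below full j) *: (M i * z i j * N j) =
      e ^+ below full j *: ((if j == ord0 then e ^+ r *: wedge_word q zT (enum top) vac top
        else if j == ord_max then wedge_word q zT (enum bottom) vac top else 0) * N j).
    rewrite -col_expansion mulr_suml scaler_sumr; apply: eq_bigr => i _.
    by rewrite -scalerAl scalerA mulrC.
  under eq_bigr => j _ do rewrite colE.
  rewrite (bigD1 ord0) // (bigD1 ord_max) ?max_full //=.
  rewrite big1 => [|j /andP[/andP[_ /negPf->] /negPf->]]; last first.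
    by rewrite mul0r scaler0.
  rewrite addr0 below0 belowmax /N full0 fullmax scale1r eqxx (exprSr e r).
  rewrite -(qminor_cols tt qz) -(qminor_cols tb qz) -(qminor_rows _ bb) -(qminor_rows _ bt).
  by rewrite -scalerAl -scalerA -scalerDr scaleNr.
apply/eqP; rewrite -subr_eq; apply/eqP.
by apply: (scalerI (expf_neq0 r e0)); rewrite -rows -cols.
Qed.

End Jacobi.

(** * The block of generators *)

Lemma Z_quantum_matrix (K : fieldType) (q : K) m n :
  quantum_matrix q (@Z K q m n).
Proof.
pose p (f : freealg K m n) : Oq q m n := (\pi_(Oq q m n) f)%qT.
have pZ i j s t : Z i j * Z s t = p (letter i j * letter s t) := Oq_pi_mul _ _.
have pS c f : c *: p f = p (c *: f) := Oq_pi_scale c f.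
have pD f g : p f + p g = p (f + g) := Oq_pi_add f g.
have prel f g : Oq_rel q f g -> p f = p g.
  by move=> fg; apply/Oq_piP; apply: Oq_ideal_gen.
split=> [i j k jk|i k j ik|i s j t si jt|i s j t is_ jt]; rewrite !pZ ?pS ?pD; apply: prel.
- exact: Oq_rel_row.
- exact: Oq_rel_col.
- exact: Oq_rel_anti.
- exact: Oq_rel_diag.
Qed.

Lemma block_Z_quantum_matrix (K : fieldType) (q : K) (n0 r0 s : nat) (i0 : 'I_n0) (j0 : 'I_r0)
    (hi : (i0 + s - 1 < n0)%N) (hj : (j0 + s - 1 < r0)%N) :
  quantum_matrix q (block_Z q hi hj).
Proof.
have [row col anti diag] := @Z_quantum_matrix K q n0 r0.
split=> [i j k jk|i k j ik|i t j u ti ju|i t j u it ju]; apply: val_inj;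
  rewrite ?raddfD ?linearZ ?rmorphM /=.
- by apply: row; rewrite /= ltn_add2l.
- by apply: col; rewrite /= ltn_add2l.
- by apply: anti; rewrite /= ltn_add2l.
- by apply: diag; rewrite /= ltn_add2l.
Qed.

Lemma q_var_neq0 : q_var != 0.
Proof. by rewrite tofrac_eq0 polyX_eq0. Qed.

Theorem theorem6p17 (n0 r0 : nat) (n0_gt0 : (0 < n0)%N) (r0_gt0 : (0 < r0)%N)
    (i0 : 'I_n0) (j0 : 'I_r0) (s : nat) (s_gt0 : (0 < s)%N)
    (hi : (i0 + s - 1 < n0)%N) (hj : (j0 + s - 1 < r0)%N)
    (s_max : forall s' : nat, (0 < s')%N ->
       (i0 + s' - 1 < n0)%N -> (j0 + s' - 1 < r0)%N -> (s' <= s)%N)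
    (s_ge2 : (2 <= s)%N) :
  let z : 'I_s -> 'I_s -> block_subalg q_var hi hj := block_Z q_var hi hj in
  let top := itv_set s 0 (s - 1) in
  let bottom := itv_set s 1 s in
  let middle := itv_set s 1 (s - 1) in
  let full := itv_set s 0 s in
  let X_t := qminor q_var z (erefl #|top|) in
  let X_b := qminor q_var z (erefl #|bottom|) in
  let X_o := qminor q_var z (erefl #|middle|) in
  let D := qminor q_var z (erefl #|full|) in
  let Y_r := qminor q_var z (card_itv_set s : #|top| = #|bottom|) in
  let Y_l := qminor q_var z (esym (card_itv_set s) : #|bottom| = #|top|) in
  X_t * X_b = X_o * D + q_var ^+ 2 *: (Y_r * Y_l).
Proof.
case: s s_ge2 {s_gt0 s_max} hi hj => [|[|r]] // _ hi hj.
exact: (quantum_jacobi q_var_neq0 (block_Z_quantum_matrix _ hi hj)).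
Qed.
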